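(* Let $A\in\mathbb{R}^{m\times n}$, $\mathbf{b}\in\mathbb{R}^m$, $\mathbf{c},\mathbf{d},\boldsymbol{\varphi}\in\mathbb{R}^n$, $\varepsilon>0$. Let $I_j=[\lambda_j,\lambda_{j+1}]\subset\mathbb{R}$ be an interval on which $f_c(\lambda)=\min\{(\mathbf{c}+\lambda\mathbf{d})^t\mathbf{x}: A\mathbf{x}\le\mathbf{b},\ \mathbf{x}\ge0\}$ is finite and given by $f_c(\lambda)=\alpha_j\lambda+\beta_j$ for constants $\alpha_j,\beta_j\in\mathbb{R}$. For $\lambda\in I_j$ let $$g_c^{\varepsilon(j)}(\lambda)=\min\{\boldsymbol{\varphi}^t\mathbf{x}: A\mathbf{x}\le\mathbf{b},\ (\mathbf{c}+\lambda\mathbf{d})^t\mathbf{x}\le\alpha_j\lambda+\beta_j+\varepsilon,\ \mathbf{x}\ge0\}.$$ Suppose that the same basis $\mathcal{B}$ (of the standard form of this linear program, see context) is optimal for every $\lambda\in I_j$. Let $$A'_{\mathcal{B},0}=\begin{pmatrix}A_{\mathcal{B}}\\ \mathbf{c}_{\mathcal{B}}^t\end{pmatrix},\quad \mathbf{u}=\begin{pmatrix}0\\1\end{pmatrix},\quad \mathbf{v}^t=\begin{pmatrix}0&\mathbf{d}_{\mathcal{B}}^t\end{pmatrix},\quad \mathbf{b}_0=\begin{pmatrix}\mathbf{b}\\ \beta_j+\varepsilon\end{pmatrix}$$ (where $\mathbf{v}^t$ is the row vector $\mathbf{d}_{\mathcal B}^t$ of length $m+1$, so that $\mathbf{u}\mathbf{v}^t=\begin{pmatrix}0\\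 \mathbf{d}_{\mathcal{B}}^t\end{pmatrix}$), and suppose $A'_{\mathcal{B},0}$ is invertible. Then for all $\lambda\in I_j$, $$g_c^{\varepsilon(j)}(\lambda)=\theta_{\mathcal{B}}+\frac{\lambda\,\kappa_{\mathcal{B}}}{1+\lambda\,\nu_{\mathcal{B}}},$$ where $$\theta_{\mathcal{B}}=\boldsymbol{\varphi}_{\mathcal{B}}^t A_{\mathcal{B},0}'^{-1}\mathbf{b}_0,\qquad \kappa_{\mathcal{B}}=\boldsymbol{\varphi}_{\mathcal{B}}^t\left(\alpha_j-\mathbf{v}^tA_{\mathcal{B},0}'^{-1}\mathbf{b}_0\right)A_{\mathcal{B},0}'^{-1}\mathbf{u},\qquad \nu_{\mathcal{B}}=\mathbf{v}^tA_{\mathcal{B},0}'^{-1}\mathbf{u}$$ are real numbers depending on the basis $\mathcal B$ and not on $\lambda$ (so $g_c^{\varepsilon(j)}$ is a linear-fractional function of $\lambda$ on $I_j$).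
   Context: Standard form: add slack variables $\mathbf{s}\in\mathbb{R}^m_{\ge0}$ to $A\mathbf{x}\le\mathbf{b}$ and a slack $r\ge0$ to the last inequality. In the variables $(\mathbf{x},\mathbf{s},r)\in\mathbb{R}^{n+m+1}_{\ge 0}$ the constraints become $A'(\lambda)(\mathbf{x},\mathbf{s},r)^t=\mathbf{b}'(\lambda)$, where $A'(\lambda)=\begin{pmatrix}A&I_m&0\\ \mathbf{c}^t+\lambda\mathbf{d}^t&0&1\end{pmatrix}$ and $\mathbf{b}'(\lambda)=\begin{pmatrix}\mathbf{b}\\ \beta_j+\varepsilon+\lambda\alpha_j\end{pmatrix}$. A basis $\mathcal{B}$ is a set of $m+1$ column indices. It is optimal at $\lambda$ if the submatrix $A'_{\mathcal{B}}(\lambda)$ of the columns in $\mathcal{B}$ is nonsingular and the associated basic solution (basic variables equal to $A'_{\mathcal{B}}(\lambda)^{-1}\mathbf{b}'(\lambda)$, all other variables $0$) is feasible and optimal for the linear program. $A_{\mathcal{B}}$ ($m\times(m+1)$), $\mathbf{c}_{\mathcal{B}}$, $\mathbf{d}_{\mathcal{B}}$, $\boldsymbol{\varphi}_{\mathcal{B}}$ (vectors of length $m+1$) denote the restrictions to the indices in $\mathcal{B}$ of, respectively, the extended matrix $(A\ \ I_m\ \ 0)$ and the extended vectors $(\mathbf{c},0,1)$, $(\mathbf{d},0,0)$, $(\boldsymbol{\varphi},0,0)$. Thus $A'_{\mathcal{B}}(\lambda)=A'_{\mathcal{B},0}+\lambda\mathbf{u}\mathbf{v}^t$ and $\mathbf{b}'(\lambda)=\mathbf{b}_0+\lambda\alpha_j\mathbf{u}$.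 *)

(* Defs.v *)
From HB Require Import structures.
From mathcomp Require Import all_boot all_order all_algebra.
From mathcomp Require Import classical_sets reals.

Set Implicit Arguments.
Unset Strict Implicit.
Unset Printing Implicit Defensive.

Import Order.TTheory GRing.Theory Num.Theory.
Local Open Scope ring_scope.
Local Open Scope classical_set_scope.

Section LinearPrograms.
Variable R : realType.

Definition dot k (x y : 'cV[R]_k) : R := (x^T *m y) 0 0.

Definition mxle k (x y : 'cV[R]_k) : Prop := forall i, x i 0 <= y i 0.

(* The minimum is attained: in particular the set of values is nonempty and
   bounded below. *)
Definition is_min (S : set R) (v : R) : Prop := S v /\ lbound S v.

Definition lp_min k (F : set 'cV[R]_k) (cost : 'cV[R]_k) (v : R) : Prop :=
  is_min [set dot cost x | x in F] v.

Definition polyhedron m n (A : 'M[R]_(m, n)) (b : 'cV[R]_m) : set 'cV[R]_n :=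
  [set x | mxle (A *m x) b /\ mxle 0 x].

Definition budget_polyhedron m n (A : 'M[R]_(m, n)) (b : 'cV[R]_m)
    (cost : 'cV[R]_n) (B : R) : set 'cV[R]_n :=
  [set x | [/\ mxle (A *m x) b, dot cost x <= B & mxle 0 x]].

Definition std_feasible p q (M : 'M[R]_(p, q)) (rhs : 'cV[R]_p) : set 'cV[R]_q :=
  [set z | M *m z = rhs /\ mxle 0 z].

Definition std_optimal p q (M : 'M[R]_(p, q)) (rhs : 'cV[R]_p)
    (cost z : 'cV[R]_q) : Prop :=
  std_feasible M rhs z /\
  (forall z', std_feasible M rhs z' -> dot cost z <= dot cost z').

(* The increasing enumeration of the basis B; it fixes the order in which the
   columns indexed by B appear in the submatrices below. *)
Definition basis_idx p q (B : {set 'I_q}) (hB : #|B| = p) (k : 'I_p) : 'I_q :=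
  enum_val (cast_ord (esym hB) k).

Definition basis_cols p q (B : {set 'I_q}) (hB : #|B| = p) r
    (M : 'M[R]_(r, q)) : 'M[R]_(r, p) := colsub (basis_idx hB) M.

Definition basis_rows p q (B : {set 'I_q}) (hB : #|B| = p)
    (x : 'cV[R]_q) : 'cV[R]_p := rowsub (basis_idx hB) x.

(* At i in B the inner sum has exactly one term, the basic variable
   corresponding to i; at i outside B it is empty, hence 0. *)
Definition basic_solution p q (B : {set 'I_q}) (hB : #|B| = p)
    (M : 'M[R]_(p, q)) (rhs : 'cV[R]_p) : 'cV[R]_q :=
  \col_i \sum_(k | basis_idx hB k == i) (invmx (basis_cols hB M) *m rhs) k 0.

Definition optimal_basis p q (B : {set 'I_q}) (hB : #|B| = p)
    (M : 'M[R]_(p, q)) (rhs : 'cV[R]_p) (cost : 'cV[R]_q) : Prop :=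
  basis_cols hB M \in unitmx /\
  std_optimal M rhs cost (basic_solution hB M rhs).

(* The variables of the standard form are (x, s, r), with n + m + 1 entries. *)
Definition ext_mx m n (A : 'M[R]_(m, n)) : 'M[R]_(m, n + m + 1) :=
  row_mx (row_mx A 1%:M) 0.

(* Extends x by 0 on the slacks s and by the second argument on the slack r. *)
Definition ext_cV m n (x : 'cV[R]_n) (r : R) : 'cV[R]_(n + m + 1) :=
  col_mx (col_mx x 0) r%:M.

Definition std_mx m n (A : 'M[R]_(m, n)) (c d : 'cV[R]_n) (lam : R) :
    'M[R]_(m + 1, n + m + 1) :=
  col_mx (ext_mx A) (row_mx (row_mx (c^T + lam *: d^T) 0) 1%:M).

Definition std_rhs m (b : 'cV[R]_m) (alpha beta eps lam : R) : 'cV[R]_(m + 1) :=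
  col_mx b (beta + eps + lam * alpha)%:M.

End LinearPrograms.

Arguments ext_cV {R} m {n} x r.

(* Main.v *)
Require Import Defs.
From mathcomp Require Import all_boot all_order all_algebra.
From mathcomp Require Import classical_sets reals.

Set Implicit Arguments.
Unset Strict Implicit.
Unset Printing Implicit Defensive.

Import Order.TTheory GRing.Theory Num.Theory.
Local Open Scope ring_scope.

(** The minimum of the program with budget constraint is the cost of the basic
solution of its standard form, since the slack variables cost nothing
([lp_min_budget_of_std_optimal]), and that cost only involves the basic
variables ([dot_basic_solution]).  Hence the minimum at [lam] is
[dot phiB xB], where [xB] solves the square system
[(A0 + lam *: (u *m v^T)) *m xB = b0 + (lam * alpha) *: u].

The parameter only moves the last row of this system, so the solution moves
along the fixed line through [y := invmx A0 *m b0] directed by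
[w := invmx A0 *m u]: substituting [xB = y + t *: w] leaves the scalar equation
[t * (1 + lam * nu) = lam * (alpha - dot v y)].  The factor [1 + lam * nu]
cannot vanish, as otherwise [w] would be a nonzero vector in the kernel of the
basis matrix at [lam] ([solve_rank_one_update]).  Solving for [t] and applying
[dot phiB] gives the linear-fractional formula. *)

Section ParametricStandardForm.
Variable R : realType.

Lemma dotDr k (x y z : 'cV[R]_k) : dot x (y + z) = dot x y + dot x z.
Proof. by rewrite /dot mulmxDr mxE. Qed.

Lemma dotZr k (x y : 'cV[R]_k) a : dot x (a *: y) = a * dot x y.
Proof. by rewrite /dot -scalemxAr mxE. Qed.

Lemma tr_mulmx_dot k (x y : 'cV[R]_k) : x^T *m y = (dot x y)%:M.
Proof. exact: mx11_scalar. Qed.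

Lemma dot_col_mx k l (x1 y1 : 'cV[R]_k) (x2 y2 : 'cV[R]_l) :
  dot (col_mx x1 x2) (col_mx y1 y2) = dot x1 y1 + dot x2 y2.
Proof. by rewrite /dot tr_col_mx mul_row_col mxE. Qed.

Lemma mxle_col_mx k l (x1 y1 : 'cV[R]_k) (x2 y2 : 'cV[R]_l) :
  mxle (col_mx x1 x2) (col_mx y1 y2) <-> mxle x1 y1 /\ mxle x2 y2.
Proof.
split=> [le_xy|[le1 le2] i].
  split=> i.
    by have := le_xy (lshift l i); rewrite !col_mxEu.
  by have := le_xy (rshift k i); rewrite !col_mxEd.
by case: (split_ordP i) => j ->; rewrite ?col_mxEu ?col_mxEd.
Qed.

Lemma std_feasible_col_mx m n (A : 'M[R]_(m, n)) (b : 'cV[R]_m)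
    (c d x : 'cV[R]_n) (s : 'cV[R]_m) (r alpha beta eps lam : R) :
  std_feasible (std_mx A c d lam) (std_rhs b alpha beta eps lam)
      (col_mx (col_mx x s) r%:M) <->
  [/\ A *m x + s = b,
      dot (c + lam *: d) x + r = alpha * lam + beta + eps,
      mxle 0 x, mxle 0 s & 0 <= r].
Proof.
rewrite /std_feasible /std_mx /std_rhs /ext_mx /=.
rewrite !mul_col_mx !mul_row_col !mul1mx !mul0mx !addr0.
have -> : c^T + lam *: d^T = (c + lam *: d)^T by rewrite linearD linearZ.
rewrite tr_mulmx_dot -raddfD /=.
have -> : beta + eps + lam * alpha = alpha * lam + beta + eps.
  by rewrite addrC addrA mulrC.
have -> : 0 = col_mx (col_mx 0 0) 0 :> 'cV[R]_(n + m + 1) by rewrite !col_mx0.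
have r_ge0 : mxle 0 (r%:M : 'cV[R]_1) <-> 0 <= r.
  split=> [/(_ 0)|r0 i]; first by rewrite !mxE.
  by rewrite (ord1 i) !mxE.
split.
  case=> /eq_col_mx[-> /(congr1 (fun N : 'M[R]_1 => N 0 0))].
  rewrite !mxE eqxx !mulr1n => ->.
  by case/mxle_col_mx => /mxle_col_mx[? ?] /r_ge0 ?.
case=> -> -> x0 s0 /r_ge0 r0; split=> //.
by apply/mxle_col_mx; split=> //; apply/mxle_col_mx.
Qed.

Lemma dot_ext_cV m n (phi x : 'cV[R]_n) (s : 'cV[R]_m) (p : R) (r : 'cV[R]_1) :
  dot (ext_cV m phi p) (col_mx (col_mx x s) r) = dot phi x + p * r 0 0.
Proof.
rewrite /ext_cV !dot_col_mx /dot trmx0 mul0mx tr_scalar_mx mul_scalar_mx.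
by rewrite !mxE addr0.
Qed.

(** A point [x] of the budget polyhedron extends by its slacks to a feasible
point of the standard form, which projects back to [x]; both maps preserve the
cost, because the slacks have cost zero. *)
Lemma lp_min_budget_of_std_optimal m n (A : 'M[R]_(m, n)) (b : 'cV[R]_m)
    (c d phi : 'cV[R]_n) (alpha beta eps lam : R) (z : 'cV[R]_(n + m + 1)) :
  std_optimal (std_mx A c d lam) (std_rhs b alpha beta eps lam)
    (ext_cV m phi 0) z ->
  lp_min (budget_polyhedron A b (c + lam *: d) (alpha * lam + beta + eps)) phi
    (dot (ext_cV m phi 0) z).
Proof.
rewrite -[z]vsubmxK -[usubmx z]vsubmxK [dsubmx z]mx11_scalar.
move: (usubmx (usubmx z)) (dsubmx (usubmx z)) (dsubmx z 0 0) => x s r.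
case=> /std_feasible_col_mx[Ax_s cx_r x_ge0 s_ge0 r_ge0] z_min.
rewrite dot_ext_cV mul0r addr0; split=> [|_ [x' [Ax'_le cx'_le x'_ge0] <-]].
  exists x => //; split=> //; last by rewrite -cx_r lerDl.
  by move=> i; rewrite -Ax_s [leRHS]mxE lerDl; have := s_ge0 i; rewrite mxE.
pose r' := alpha * lam + beta + eps - dot (c + lam *: d) x'.
have := z_min (col_mx (col_mx x' (b - A *m x')) r'%:M).
rewrite !dot_ext_cV !mul0r !addr0; apply.
apply/std_feasible_col_mx; split=> //; rewrite ?subr_ge0 //.
- by rewrite addrC subrK.
- by rewrite addrC subrK.
by move=> i; rewrite 3!mxE subr_ge0; apply: Ax'_le.
Qed.

Lemma dot_basic_solution p q (B : {set 'I_q}) (hB : #|B| = p)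
    (M : 'M[R]_(p, q)) (rhs : 'cV[R]_p) (cost : 'cV[R]_q) :
  dot cost (basic_solution hB M rhs) =
  dot (basis_rows hB cost) (invmx (basis_cols hB M) *m rhs).
Proof.
rewrite /dot /basic_solution; move: (invmx _ *m rhs) => xB.
rewrite [LHS]mxE [RHS]mxE.
under eq_bigr do rewrite !mxE big_distrr big_mkcond /=.
rewrite exchange_big; apply: eq_bigr => k _ /=.
by rewrite -big_mkcond /= (big_pred1 (basis_idx hB k)) ?mxE.

Qed.

Lemma std_mx_rank_one m n (A : 'M[R]_(m, n)) (c d : 'cV[R]_n) (lam : R) :
  std_mx A c d lam = col_mx (ext_mx A) (ext_cV m c 1)^T
                     + lam *: (col_mx 0 1%:M *m (ext_cV m d 0)^T).
Proof.
rewrite /std_mx /ext_cV !tr_col_mx !trmx0 !tr_scalar_mx mul_col_mx mul0mx.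
rewrite mul1mx scale_col_mx add_col_mx scaler0 addr0 !scale_row_mx.
by rewrite !add_row_mx scaler0 addr0 raddf0 scaler0 addr0.
Qed.

Lemma basis_cols_std_mx m n (A : 'M[R]_(m, n)) (c d : 'cV[R]_n) (lam : R)
    (B : {set 'I_(n + m + 1)}) (hB : #|B| = (m + 1)%N) :
  basis_cols hB (std_mx A c d lam) =
  col_mx (basis_cols hB (ext_mx A)) (basis_rows hB (ext_cV m c 1))^T
  + lam *: (col_mx 0 1%:M *m (basis_rows hB (ext_cV m d 0))^T).
Proof.
rewrite std_mx_rank_one /basis_cols /basis_rows !trmx_mxsub linearD linearZ /=.
rewrite -mulmx_colsub; congr (_ + _).
apply/matrixP => i j; rewrite mxE.
by case: (split_ordP i) => k ->; rewrite ?col_mxEu ?col_mxEd [RHS]mxE.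
Qed.

(** Along the line [y + t *: w], with [y := invmx N *m b0] and
[w := invmx N *m u], the updated matrix only produces multiples of [u] added
to [b0], so that solving the updated system amounts to a scalar equation
in [t]. *)
Lemma solve_rank_one_update k (N : 'M[R]_k) (u v b0 : 'cV[R]_k) (lam a : R) :
  N \in unitmx -> N + lam *: (u *m v^T) \in unitmx -> u != 0 ->
  1 + lam * dot v (invmx N *m u) != 0 /\
  invmx (N + lam *: (u *m v^T)) *m (b0 + (lam * a) *: u) =
    invmx N *m b0
    + (lam / (1 + lam * dot v (invmx N *m u)))
        *: ((a - dot v (invmx N *m b0)) *: (invmx N *m u)).
Proof.
move=> N_unit; set M := N + _ => M_unit u_neq0.
set y := invmx N *m b0; set w := invmx N *m u.
have Ny : N *m y = b0 by rewrite mulKVmx.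
have Nw : N *m w = u by rewrite mulKVmx.
have ME x : M *m x = N *m x + (lam * dot v x) *: u.
  by rewrite mulmxDl -scalemxAl -mulmxA tr_mulmx_dot mul_mx_scalar scalerA.
have Mw : M *m w = (1 + lam * dot v w) *: u by rewrite ME Nw scalerDl scale1r.
have nu_neq0 : 1 + lam * dot v w != 0.
  apply: contra_neq u_neq0 => nu0.
  by rewrite -Nw -(mulKmx M_unit w) Mw nu0 scale0r !mulmx0.
split=> //; apply: (canLR (mulKmx M_unit)).
rewrite mulmxDr -!scalemxAr Mw ME Ny !scalerA -addrA -scalerDl.
congr (_ + _ *: _); rewrite mulrAC divfK //.
by rewrite mulrBr addrC subrK.
Qed.

End ParametricStandardForm.

Theorem theorem5 (R : realType) (m n : nat) (A : 'M[R]_(m, n)) (b : 'cV[R]_m)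
    (c d phi : 'cV[R]_n) (eps : R) (eps_gt0 : 0 < eps)
    (lam_j lam_j1 alpha beta : R)
    (f_c_affine : forall lam : R, lam_j <= lam <= lam_j1 ->
       lp_min (polyhedron A b) (c + lam *: d) (alpha * lam + beta))
    (B : {set 'I_(n + m + 1)}) (hB : #|B| = (m + 1)%N)
    (B_optimal : forall lam : R, lam_j <= lam <= lam_j1 ->
       optimal_basis hB (std_mx A c d lam) (std_rhs b alpha beta eps lam)
         (ext_cV m phi 0)) :
  let phiB : 'cV[R]_(m + 1) := basis_rows hB (ext_cV m phi 0) in
  let A0 : 'M[R]_(m + 1) :=
    col_mx (basis_cols hB (ext_mx A)) (basis_rows hB (ext_cV m c 1))^T in
  let u : 'cV[R]_(m + 1) := col_mx 0 1%:M in
  let v : 'cV[R]_(m + 1) := basis_rows hB (ext_cV m d 0) in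
  let b0 : 'cV[R]_(m + 1) := col_mx b (beta + eps)%:M in
  A0 \in unitmx ->
  let theta : R := dot phiB (invmx A0 *m b0) in
  let kappa : R :=
    dot phiB ((alpha - dot v (invmx A0 *m b0)) *: (invmx A0 *m u)) in
  let nu : R := dot v (invmx A0 *m u) in
  forall lam : R, lam_j <= lam <= lam_j1 ->
    1 + lam * nu != 0 /\
    lp_min (budget_polyhedron A b (c + lam *: d) (alpha * lam + beta + eps)) phi
      (theta + lam * kappa / (1 + lam * nu)).
Proof.
move=> phiB A0 u v b0 A0_unit theta kappa nu lam lam_in.
have [] := B_optimal lam lam_in.
move=> + /lp_min_budget_of_std_optimal.
rewrite dot_basic_solution basis_cols_std_mx -/A0 -/u -/v -/phiB => M_unit.
have -> : std_rhs b alpha beta eps lam = b0 + (lam * alpha) *: u.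
  rewrite /std_rhs /b0 /u scale_col_mx add_col_mx scaler0 addr0.
  by rewrite scale_scalar_mx mulr1 -raddfD.
have u_neq0 : u != 0.
  apply/eqP => /(congr1 (fun x : 'cV[R]_(m + 1) => x (rshift m 0) 0)).
  by rewrite col_mxEd !mxE eqxx => /eqP; rewrite oner_eq0.
have [nu_neq0 ->] := solve_rank_one_update b0 alpha A0_unit M_unit u_neq0.
by rewrite dotDr [dot phiB (_ *: (_ *: _))]dotZr mulrAC.
Qed.
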